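(* Let $(G,i)$ be a filter pair over $\Sigma$ and $l=(\Sigma,\vdash^X)$ the associated logic with an infinite set of variables $X$. Let $Z$ be another set and $F\subseteq Fm(Z)$ an $l$-filter. Then $F=i_{Fm(Z)}(\Xi_{Fm(Z)}(F))$. In particular all $l$-filters in absolutely free algebras lie in the image of $i$.
   Context: $\Sigma$-Str is the category of $\Sigma$-structures and homomorphisms; $Fm(X)$ is the absolutely free $\Sigma$-structure on a set $X$. $AL$ is the category of algebraic lattices with maps preserving arbitrary meets and directed joins. A filter pair over $\Sigma$ is a pair $(G,i)$ of a contravariant functor $G:\Sigma\text{-Str}\to AL$ and maps $i_A:G(A)\to(\mathcal{P}(A),\subseteq)$, one for each $\Sigma$-structure $A$, preserving arbitrary infima (in particular $i_A(\top)=A$) and directed suprema, such that $i_A\circ G(h)=h^{-1}\circ i_B$ for every homomorphism $h:A\to B$. $\Xi_A:\mathcal{P}(A)\to G(A)$ denotes the left adjoint of $i_A$ ($\Xi_A(D)\leq z\iff D\subseteq i_A(z)$), which exists since $i_A$ preserves infima. The associated logic $(\Sigma,\vdash^X)$: for $\Gamma\cup\{\varphi\}\subseteq Fm(X)$, $\Gamma\vdash^X\varphi$ iff for every $a\in G(Fm(X))$, $\Gamma\subseteq i_{Fm(X)}(a)$ implies $\varphi\in i_{Fm(X)}(a)$. An $l$-filter on a $\Sigma$-structure $A$ is a subset $F\subseteq A$ such that whenever $\Gamma\vdash^X\varphi$ and $v:Fm(X)\to A$ is a homomorphism with $v[\Gamma]\subseteq F$, then $v(\varphi)\in F$. *)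

(* Defs.v *)
From mathcomp Require Import all_boot all_order.
From mathcomp Require Import boolp classical_sets functions cardinality.

Set Implicit Arguments.
Unset Strict Implicit.
Unset Printing Implicit Defensive.

Import Order.TTheory.
Local Open Scope classical_set_scope.

(* An n-ary operation on A is a function ('I_n -> A) -> A; carriers may be
   empty. *)

Definition signature := nat -> Type.

Record structure (Sg : signature) := Structure {
  carrier :> Type;
  interp : forall n, Sg n -> ('I_n -> carrier) -> carrier }.

Record hom (Sg : signature) (A B : structure Sg) := Hom {
  hom_fun :> A -> B;
  hom_interp : forall n (c : Sg n) (a : 'I_n -> A),
    hom_fun (interp c a) = interp c (fun j => hom_fun (a j)) }.

Lemma hom_eq (Sg : signature) (A B : structure Sg) (h k : hom A B) :
  h =1 k -> h = k.
Proof.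
case: h k => [h hP] [k kP] /= /funext hk; case: _ / hk in kP *.
by congr Hom; exact: Prop_irrelevance.
Qed.

Definition hom_id (Sg : signature) (A : structure Sg) : hom A A :=
  @Hom Sg A A id (fun _ _ _ => erefl).

Lemma hom_comp_interp (Sg : signature) (A B C : structure Sg)
    (g : hom B C) (h : hom A B) n (c : Sg n) (a : 'I_n -> A) :
  (g \o h) (interp c a) = interp c (fun j => (g \o h) (a j)).
Proof. by rewrite /= !hom_interp. Qed.

Definition hom_comp (Sg : signature) (A B C : structure Sg)
    (g : hom B C) (h : hom A B) : hom A C := Hom (hom_comp_interp g h).

Inductive term (Sg : signature) (X : Type) : Type :=
| Var of X
| App n of Sg n & ('I_n -> term Sg X).

Definition Fm (Sg : signature) (X : Type) : structure Sg :=
  @Structure Sg (term Sg X) (@App Sg X).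

Lemma Fm_free (Sg : signature) (X : Type) (A : structure Sg) (v : X -> A) :
  exists! h : hom (Fm Sg X) A, forall x, h (Var Sg x) = v x.
Proof.
pose ev := fix ev (t : term Sg X) : A := match t with
  | Var x => v x
  | App n c a => interp c (fun j => ev (a j))
  end.
exists (@Hom Sg (Fm Sg X) A ev (fun _ _ _ => erefl)); split=> // h hv.
apply: hom_eq; elim=> [x|n c a IH] /=; first by rewrite hv.
rewrite -[App c a]/(interp (s := Fm Sg X) c a) hom_interp.
by congr interp; apply: funext.
Qed.

Definition directed {d} {T : porderType d} (D : set T) : Prop :=
  D !=set0 /\
  forall x y, D x -> D y -> exists z, [/\ D z, (x <= z)%O & (y <= z)%O].

Definition compact_elt {d} {T : porderType d} (c : T) : Prop :=
  forall (D : set T) (s : T), directed D -> supremums D s -> (c <= s)%O ->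
    exists2 x, D x & (c <= x)%O.

Record algLattice := AlgLattice {
  al_disp : Order.disp_t;
  al_sort :> porderType al_disp;
  al_inf : forall S : set al_sort, exists m, infimums S m;
  al_sup : forall S : set al_sort, exists s, supremums S s;
  al_compact : forall x : al_sort,
    supremums [set c | compact_elt c /\ (c <= x)%O] x }.

Definition preserves_infs {d d'} {T : porderType d} {T' : porderType d'}
    (f : T -> T') : Prop :=
  forall (S : set T) (m : T), infimums S m -> infimums (f @` S) (f m).

Definition preserves_directed_sups {d d'} {T : porderType d}
    {T' : porderType d'} (f : T -> T') : Prop :=
  forall (D : set T) (s : T), directed D ->
    supremums D s -> supremums (f @` D) (f s).

Record alg_functor (Sg : signature) := AlgFunctor {
  fobj :> structure Sg -> algLattice;
  fmap : forall A B : structure Sg, hom A B -> fobj B -> fobj A;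
  fmap_infs : forall A B (h : hom A B), preserves_infs (fmap h);
  fmap_sups : forall A B (h : hom A B), preserves_directed_sups (fmap h);
  fmap_id : forall A : structure Sg, fmap (hom_id A) =1 id;
  fmap_comp : forall (A B C : structure Sg) (g : hom B C) (h : hom A B),
    fmap (hom_comp g h) =1 fmap h \o fmap g }.

(* set A carries the inclusion order, so the infimum of the empty family is
   [set: A] and fp_infs includes the preservation of the top element. *)
Record filter_pair (Sg : signature) := FilterPair {
  fp_functor :> alg_functor Sg;
  fp_map : forall A : structure Sg, fp_functor A -> set A;
  fp_infs : forall A : structure Sg, preserves_infs (@fp_map A);
  fp_sups : forall A : structure Sg, preserves_directed_sups (@fp_map A);
  fp_natural : forall (A B : structure Sg) (h : hom A B) (b : fp_functor B),
    fp_map (fmap h b) = h @^-1` fp_map b }.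

Definition is_left_adjoint {d d'} {T : porderType d} {T' : porderType d'}
    (f : T' -> T) (g : T -> T') : Prop :=
  forall (x : T') (z : T), (f x <= z)%O <-> (x <= g z)%O.

Arguments fp_map {Sg} f A _.

Lemma Xi_exists (Sg : signature) (P : filter_pair Sg) (A : structure Sg) :
  exists f : set A -> P A, is_left_adjoint f (fp_map P A).
Proof.
have mono (x y : P A) : (x <= y)%O -> (fp_map P A x <= fp_map P A y)%O.
  move=> xy; have /fp_infs[+ _] : infimums [set x; y] x.
    by split=> [z [->|->]//|z]; apply; left.
  by apply; exists y => //; right.
have [f fP] := choice (fun D => al_inf [set z : P A | (D <= fp_map P A z)%O]).
exists f => D z; split=> [fz|Dz]; last exact: (fP D).1.
have /fp_infs[_ Hub] := fP D.
apply: le_trans (mono _ _ fz); apply: Hub => _ [y Dy <-]; exact: Dy.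
Qed.

Definition Xi (Sg : signature) (P : filter_pair Sg) (A : structure Sg) :
  set A -> P A := projT1 (cid (Xi_exists P A)).

Arguments Xi {Sg} P A _.

Lemma Xi_adjoint (Sg : signature) (P : filter_pair Sg) (A : structure Sg)
    (D : set A) (z : P A) : (Xi P A D <= z)%O <-> D `<=` fp_map P A z.
Proof.
rewrite /Xi; case: cid => f /= fP.
by apply: (iff_trans (fP D z)); rewrite subsetEset.
Qed.

Definition logic (Sg : signature) (X : Type) :=
  set (Fm Sg X) -> Fm Sg X -> Prop.

Definition assoc_logic (Sg : signature) (P : filter_pair Sg) (X : Type) :
    logic Sg X :=
  fun Gamma phi => forall a : P (Fm Sg X),
    Gamma `<=` fp_map P (Fm Sg X) a -> fp_map P (Fm Sg X) a phi.

Arguments assoc_logic {Sg} P X _ _.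

Definition is_filter (Sg : signature) (X : Type) (l : logic Sg X)
    (A : structure Sg) (F : set A) : Prop :=
  forall (Gamma : set (Fm Sg X)) (phi : Fm Sg X) (v : hom (Fm Sg X) A),
    l Gamma phi -> v @` Gamma `<=` F -> F (v phi).

(* Main.v *)
(** Since [i] preserves directed suprema, [i o Xi] is a finitary closure
    operator, so an element [phi] of [i (Xi F)] already lies in [i (Xi Gamma)]
    for a finite [Gamma] included in [F].  Only finitely many variables of [Z]
    occur in [Gamma] and [phi]; they can be renamed injectively into [X] by a
    substitution [s] with a left inverse [t] on the terms concerned.  By
    naturality of [i] along [s], [s Gamma] entails [s phi] in the associated
    logic, and the filter condition for [t] gives [phi = t (s phi)] in [F]. *)

Require Import Defs.
From mathcomp Require Import all_boot all_order.
From mathcomp Require Import boolp classical_sets functions cardinality.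
Local Open Scope classical_set_scope.

Lemma supremums_set {T : Type} (D : set (set T)) (S : set T) :
  supremums D S -> S `<=` \bigcup_(A in D) A.
Proof.
case=> _ Slub; rewrite -subsetEset; apply: Slub => A DA.
by rewrite subsetEset; exact: bigcup_sup.
Qed.

Lemma infinite_set_injective {Z X : Type} (V : set Z) :
  infinite_set [set: X] -> finite_set V ->
  exists f : Z -> X, {in V &, injective f}.
Proof.
(* Extending an injection on [V] to all of [Z] takes a default value in [X]; an empty [X] is
   excluded by infinitude. *)
elim/Ppointed: X => X; first by rewrite emptyE; move/(_ (finite_set0 _)).
move=> /infiniteP Xinf /finite_set_countable Vfin.
exact/pcard_injP/(card_le_trans Vfin).
Qed.

Section Xi.
Context {Sg : signature} {P : filter_pair Sg} {A : structure Sg}.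
Implicit Types (D E F : set A) (z : P A).

Lemma Xi_sub {D} : D `<=` fp_map P A (Xi P A D).
Proof. exact/Xi_adjoint. Qed.

Lemma Xi_mono {D E} : D `<=` E -> (Xi P A D <= Xi P A E)%O.
Proof. by move=> DE; apply/Xi_adjoint; exact: subset_trans DE Xi_sub. Qed.

Lemma fp_map_Xi_sub {D z} :
  D `<=` fp_map P A z -> fp_map P A (Xi P A D) `<=` fp_map P A z.
Proof.
move=> Dz; apply/Xi_adjoint; apply: Order.POrderTheory.le_trans; last first.
  exact/Xi_adjoint/Dz.
by apply/Xi_adjoint.
Qed.

(** [Xi F] is the directed supremum of the [Xi D] for finite [D] inside [F], and [fp_map] turns it
    into a supremum of sets, which lies in their union. *)
Lemma fp_map_Xi_finitary {F} {phi : A} : fp_map P A (Xi P A F) phi ->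
  exists D, [/\ finite_set D, D `<=` F & fp_map P A (Xi P A D) phi].
Proof.
pose fins := [set D | finite_set D /\ D `<=` F].
have fins_directed : directed (Xi P A @` fins).
  split; first by exists (Xi P A set0), set0 => //; split=> [|x []].
  move=> _ _ [D [Dfin DF] <-] [E [Efin EF] <-]; exists (Xi P A (D `|` E)).
  split; [|exact/Xi_mono/subsetUl|exact/Xi_mono/subsetUr].
  by exists (D `|` E) => //; rewrite /fins/= finite_setU subUset.
have Xi_sup : supremums (Xi P A @` fins) (Xi P A F).
  split=> [_ [D [_ DF] <-]|z zub]; first exact: Xi_mono.
  (* Singletons of elements of [F] already force an upper bound above [Xi F]. *)
  apply/Xi_adjoint => x Fx.
  have /Xi_adjoint : (Xi P A [set x] <= z)%O.
    by apply: zub; exists [set x] => //; split=> // _ ->.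
  exact.
move=> /(supremums_set _ _ (fp_sups fins_directed Xi_sup)).
by case=> _ [_ [D [Dfin DF] <-] <-] Dphi; exists D.
Qed.

End Xi.

(** By naturality the preimage under [s] of a set in the image of [fp_map] is again in that image,
    so it contains the closure of [D] once it contains [D]. *)
Lemma assoc_logic_hom {Sg : signature} {P : filter_pair Sg} {X : Type}
    {A : structure Sg} {s : hom A (Fm Sg X)} {D : set A} {phi : A} :
  fp_map P A (Xi P A D) phi -> assoc_logic P X (s @` D) (s phi).
Proof.
move=> Dphi a sDa.
suff : (s @^-1` fp_map P (Fm Sg X) a) phi by [].
rewrite -fp_natural; apply: fp_map_Xi_sub Dphi => x Dx.
by rewrite fp_natural; apply: sDa; exists x.
Qed.

Fixpoint vars {Sg : signature} {Z : Type} (t : term Sg Z) : set Z :=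
  match t with
  | Var z => [set z]
  | App n c a => \bigcup_j vars (a j)
  end.

(** The finite arities of the signature enter here. *)
Lemma finite_vars {Sg : signature} {Z : Type} (t : term Sg Z) :
  finite_set (vars t).
Proof.
elim: t => [z|n c a IH] /=; first exact: finite_set1.
by apply: bigcup_finite => [|j _]; [exact: finite_finset|exact: IH].
Qed.

Lemma hom_eq_vars {Sg : signature} {Z : Type} {A : structure Sg}
    {h k : hom (Fm Sg Z) A} {t : Fm Sg Z} :
  (forall z, vars t z -> h (Var Sg z) = k (Var Sg z)) -> h t = k t.
Proof.
elim: t => [z|n c a IH] hk; first exact: hk.
rewrite -[App c a]/(@interp Sg (Fm Sg Z) n c a) !hom_interp.
congr interp; apply: funext => j; apply: IH => z az.
by apply: hk; exists j.
Qed.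

(* [phi] is only a witness that [Fm Sg Z] is inhabited: without one there need
   not be any homomorphism [t]. *)
Lemma hom_renaming {Sg : signature} {X Z : Type} {V : set Z} (phi : Fm Sg Z) :
    infinite_set [set: X] -> finite_set V ->
  exists (s : hom (Fm Sg Z) (Fm Sg X)) (t : hom (Fm Sg X) (Fm Sg Z)),
    forall psi, vars psi `<=` V -> t (s psi) = psi.
Proof.
move=> Xinf Vfin; have [f finj] := infinite_set_injective V Xinf Vfin.
(* [g] inverts [f] on the image of [V] and takes the default value [phi] elsewhere. *)
have /choice[g gf] (x : X) :
    exists u : Fm Sg Z, forall z, V z -> f z = x -> u = Var Sg z.
  have [[z Vz <-]|xNf] := pselect ((f @` V) x).
    by exists (Var Sg z) => y Vy fyz; rewrite (finj y z) ?inE.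
  by exists phi => z Vz fzx; case: xNf; exists z.
have [s [sf _]] := Fm_free (A := Fm Sg X) (fun z => Var Sg (f z)).
have [t [tg _]] := Fm_free (A := Fm Sg Z) g.
exists s, t => psi psiV.
apply: (@hom_eq_vars _ _ _ (hom_comp t s) (hom_id (Fm Sg Z))) => z /psiV Vz.
by rewrite /= sf tg (gf (f z) z).
Qed.

Theorem proposition2p14 (Sg : signature) (P : filter_pair Sg) (X : Type)
    (hX : infinite_set [set: X]) :
  (forall (Z : Type) (F : set (Fm Sg Z)),
     is_filter (assoc_logic P X) F -> F = fp_map P (Fm Sg Z) (Xi P (Fm Sg Z) F)) /\
  (forall (Z : Type) (F : set (Fm Sg Z)),
     is_filter (assoc_logic P X) F ->
     range (fp_map P (Fm Sg Z)) F).
Proof.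
have Xi_fix (Z : Type) (F : set (Fm Sg Z)) : is_filter (assoc_logic P X) F ->
    F = fp_map P (Fm Sg Z) (Xi P (Fm Sg Z) F).
  move=> Ffilter; apply/seteqP; split=> [|phi]; first exact: Xi_sub.
  move=> /fp_map_Xi_finitary[D [Dfin DF Dphi]].
  have Vfin : finite_set (vars phi `|` \bigcup_(d in D) vars d).
    rewrite finite_setU; split; first exact: finite_vars.
    by apply: bigcup_finite => // d _; exact: finite_vars.
  have [s [t ts]] := hom_renaming phi hX Vfin.
  rewrite -(ts phi); last exact: subsetUl.
  apply: Ffilter (assoc_logic_hom Dphi) _ => _ [_ [d Dd <-] <-].
  rewrite ts; first exact: DF.
  by move=> z dz; right; exists d.
by split=> // Z F Ffilter; exists (Xi P (Fm Sg Z) F); rewrite -?Xi_fix.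
Qed.
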